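(* Let $E$ be a finite homogeneous effect algebra such that $S(E)=\{0,1\}$. Then $E$ is isomorphic (as an effect algebra) to a horizontal sum of chains.
   Context: An effect algebra is a set $E$ with two elements $0,1\in E$ and a partial binary operation $\oplus$ such that (equalities include that one side is defined iff the other is, where relevant): (i) if $x\oplus y$ is defined then $y\oplus x$ is defined and $x\oplus y=y\oplus x$; (ii) if $x\oplus y$ and $(x\oplus y)\oplus z$ are defined then $y\oplus z$ and $x\oplus(y\oplus z)$ are defined and $(x\oplus y)\oplus z=x\oplus(y\oplus z)$; (iii) for each $x\in E$ there is a unique $x'\in E$ with $x\oplus x'$ defined and equal to $1$; (iv) if $x\oplus 1$ is defined then $x=0$. Write $x\perp y$ if $x\oplus y$ is defined, and $x\le y$ if there is $z\in E$ with $x\oplus z=y$; this is a partial order with least element $0$ and greatest element $1$, and $x\perp y$ iff $x\le y'$. The set of sharp elements is $S(E)=\{x\in E: x\wedge x'=0\}$, i.e. those $x$ for which $0$ is the only element below both $x$ and $x'$. $E$ is homogeneous if whenever $u,v_1,v_2\in E$ satisfy $v_1\perp v_2$ and $u\le v_1\oplus v_2\le u'$, there exist $u_1,u_2\in E$ with $u_1\le v_1$, $u_2\le v_2$, $u_1\perp u_2$ and $u=u_1\oplus u_2$. A chain is an effect algebra whose order $\le$ is total. The horizontal sum of a nonempty family $(E_t)_{t\in T}$ of effect algebras is the effect algebra obtained from their disjoint union by identifying all the zeros $0_{E_t}$ to a single $0$ and all the units $1_{E_t}$ to a single $1$, where $x\oplus y$ is defined iff $x$ and $y$ both belong to a common $E_t$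 and $x\oplus y$ is defined in $E_t$, with the same value (a family with one member is allowed). *)

(* Defs.v *)
From HB Require Import structures.
From mathcomp Require Import all_boot.

Set Implicit Arguments.
Unset Strict Implicit.
Unset Printing Implicit Defensive.

Declare Scope effect_scope.
Delimit Scope effect_scope with EA.
Local Open Scope effect_scope.
Local Open Scope quotient_scope.

Reserved Notation "x \oplus y" (at level 50, left associativity).

(* The partial operation is option-valued; [None] means "undefined", so an
   equation between two options includes "one side is defined iff the other
   is".  The one-element algebra, where 0 = 1, satisfies the axioms. *)
HB.mixin Record isEffectAlgebra E of Choice E := {
  eazero : E;
  eaone : E;
  oplus : E -> E -> option E;
  oplusC : forall x y, oplus x y = oplus y x;
  oplusA : forall x y z u w, oplus x y = Some u -> oplus u z = Some w ->
    exists2 v, oplus y z = Some v & oplus x v = Some w;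
  ea_orthosupplement : forall x, exists! x', oplus x x' = Some eaone;
  oplus_one : forall x, oplus x eaone -> x = eazero
}.

#[short(type="effectAlgebraType")]
HB.structure Definition EffectAlgebra := { E of isEffectAlgebra E & Choice E }.

#[short(type="finEffectAlgebraType")]
HB.structure Definition FinEffectAlgebra :=
  { E of EffectAlgebra E & Finite E }.

Notation "0" := (@eazero _) : effect_scope.
Notation "1" := (@eaone _) : effect_scope.
Notation "x \oplus y" := (oplus x y) : effect_scope.

Definition ea_le (E : effectAlgebraType) (x y : E) : Prop :=
  exists z, x \oplus z = Some y.
Notation "x <= y" := (ea_le x y) : effect_scope.

Lemma ea_compl_ex (E : effectAlgebraType) (x : E) :
  exists y, x \oplus y == Some 1.
Proof. by have [y [xy _]] := ea_orthosupplement x; exists y; apply/eqP. Qed.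

Definition ea_compl (E : effectAlgebraType) (x : E) : E :=
  xchoose (ea_compl_ex x).

Definition sharp (E : effectAlgebraType) (x : E) : Prop :=
  forall y, y <= x -> y <= ea_compl x -> y = 0.

Definition homogeneous (E : effectAlgebraType) : Prop :=
  forall u v1 v2 v : E,
    v1 \oplus v2 = Some v -> u <= v -> v <= ea_compl u ->
  exists u1 u2 : E, [/\ u1 <= v1, u2 <= v2 & u1 \oplus u2 = Some u].

Definition chain (E : effectAlgebraType) : Prop :=
  forall x y : E, x <= y \/ y <= x.

Definition ea_isomorphic (E F : effectAlgebraType) : Prop :=
  exists f : E -> F, [/\ bijective f, f 0 = 0, f 1 = 1 &
    forall x y, f x \oplus f y = omap f (x \oplus y)].

Section EffectAlgebraTheory.
Variable E : effectAlgebraType.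
Implicit Types x y z : E.

Lemma ea_complP x : x \oplus ea_compl x = Some 1.
Proof. exact/eqP/(xchooseP (ea_compl_ex x)). Qed.

Lemma ea_compl_uniq x y : x \oplus y = Some 1 -> y = ea_compl x.
Proof.
have [z [_ zu]] := ea_orthosupplement x => xy.
by rewrite -(zu _ xy) -(zu _ (ea_complP x)).
Qed.

Lemma ea_complK x : ea_compl (ea_compl x) = x.
Proof. by apply/esym/ea_compl_uniq; rewrite oplusC ea_complP. Qed.

Lemma oplus10 : 1 \oplus 0 = Some 1 :> option E.
Proof.
have h := ea_complP (1 : E).
suff <- : ea_compl (1 : E) = 0 by [].
by apply: oplus_one; rewrite oplusC h.
Qed.

Lemma oplusx0 x : x \oplus 0 = Some x.
Proof.
have := @oplusA E _ _ _ _ _ (ea_complP (ea_compl x)) (oplus10); case=> v.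
by rewrite ea_complK => -> /ea_compl_uniq; rewrite ea_complK => ->.
Qed.

Lemma oplus0x x : 0 \oplus x = Some x.
Proof. by rewrite oplusC oplusx0. Qed.

Lemma oplus_eq0 x y : x \oplus y = Some 0 -> x = 0 /\ y = 0.
Proof.
suff H a b : a \oplus b = Some 0 -> b = 0 :> E.
  by move=> xy; split; [move: xy; rewrite oplusC|move: xy]; move/H.
move=> ab; have [v bv _] := @oplusA E _ _ _ _ _ ab (oplus0x 1).
by apply: oplus_one; rewrite bv.
Qed.

Lemma oplus1x x y : 1 \oplus x = Some y -> x = 0.
Proof. by move=> xy; apply: oplus_one; rewrite oplusC xy. Qed.

End EffectAlgebraTheory.

(* Gluing zeros and units of a one-element algebra to those of an algebra with
   0 <> 1 would force 0 = 1, and the result would in general not be an effect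
   algebra; horizontal sums are hence formed of families whose members
   either all satisfy 0 <> 1 or all satisfy 0 = 1. *)
Definition glueable (T : choiceType) (F : T -> effectAlgebraType) : Prop :=
  forall s t : T, 0 = 1 :> F s -> 0 = 1 :> F t.

Section HorizontalSum.
Variables (T : choiceType) (t0 : T) (F : T -> effectAlgebraType).
Hypothesis glueF : glueable F.
Implicit Types u v : {t : T & F t}.

Definition glue u v : bool :=
  [|| u == v,
      (tagged u == 0) && (tagged v == 0)
    | (tagged u == 1) && (tagged v == 1)].

Lemma glue_refl : reflexive glue.
Proof. by move=> u; rewrite /glue eqxx. Qed.

Lemma glue_sym : symmetric glue.
Proof.
by move=> u v; rewrite /glue eq_sym [X in _ || (X || _)]andbC
  [X in _ || (_ || X)]andbC.
Qed.

Lemma glue_trans : transitive glue.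
Proof.
move=> v u w /or3P[/eqP->//|/andP[u0 v0]|/andP[u1 v1]]
  /or3P[/eqP<-|/andP[v0' w0]|/andP[v1' w1]]; rewrite /glue.
- by rewrite u0 v0 orbT.
- by rewrite u0 w0 orbT.
- have z : 0 = 1 :> F (tag v) by rewrite -(eqP v0) (eqP v1').
  by rewrite u0 (eqP w1) (glueF (tag w) z) eqxx orbT.
- by rewrite u1 v1 !orbT.
- have z : 0 = 1 :> F (tag v) by rewrite -(eqP v0') (eqP v1).
  by rewrite u1 (eqP w0) (glueF (tag w) z) eqxx !orbT.
- by rewrite u1 w1 !orbT.
Qed.

Canonical glue_equiv : equiv_rel {t : T & F t} :=
  EquivRel glue glue_refl glue_sym glue_trans.

Local Notation Q := {eq_quot glue_equiv}.

(* [t0] only witnesses that the family is nonempty: the zero and the unit do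
   not depend on it, see [hsum_in0] and [hsum_in1]. *)
Definition hsum of T := Q.
Local Notation H := (hsum t0).
HB.instance Definition _ := Choice.on H.

Definition hsum_in (t : T) (a : F t) : H :=
  \pi_(Q) (Tagged F a).

(* Computed on chosen representatives: if these lie in different members, the
   sum is defined only when one of them is zero.  [hsum_oplusP] shows that this
   does not depend on the choice. *)
Definition hsum_oplus (x y : H) : option H :=
  let u := repr (x : Q) in
  let v := repr (y : Q) in
  if tag u == tag v then omap (@hsum_in (tag u)) (tagged u \oplus tagged_as u v)
  else if tagged u == 0 then Some y
  else if tagged v == 0 then Some x
  else None.

Lemma hsum_in_eq s t (a : F s) (b : F t) :
  hsum_in a = hsum_in b <->
  [\/ Tagged F a = Tagged F b, a = 0 /\ b = 0 | a = 1 /\ b = 1].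
Proof.
rewrite /hsum_in; split.
  move=> /eqmodP /or3P[/eqP|/andP[/eqP ? /eqP ?]|/andP[/eqP ? /eqP ?]];
  by [constructor 1|constructor 2|constructor 3].
move=> h; apply/eqmodP; rewrite /= /glue /=.
by case: h => [->|[-> ->]|[-> ->]]; rewrite !eqxx ?orbT.
Qed.

Lemma hsum_in_repr (x : H) :
  hsum_in (tagged (repr (x : Q))) = x.
Proof. by rewrite /hsum_in taggedK reprK. Qed.

Lemma hsum_in_surj (x : H) : exists t (a : F t), x = hsum_in a.
Proof.
by exists _, (tagged (repr (x : Q))); rewrite hsum_in_repr.
Qed.

Lemma hsum_in_inj t : injective (@hsum_in t).
Proof.
move=> a b /hsum_in_eq[/eqP|[-> ->]|[-> ->]] //.
by rewrite eq_Tagged => /eqP.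
Qed.

Lemma hsum_in0 s t : hsum_in (0 : F s) = hsum_in (0 : F t).
Proof. by apply/hsum_in_eq; constructor 2. Qed.

Lemma hsum_in1 s t : hsum_in (1 : F s) = hsum_in (1 : F t).
Proof. by apply/hsum_in_eq; constructor 3. Qed.

Lemma hsum_in_eq0 s t (a : F s) : hsum_in a = hsum_in (0 : F t) <-> a = 0.
Proof.
split=> [|->]; last exact: hsum_in0.
case/hsum_in_eq => [e|[] //|[-> z]]; last by rewrite (glueF s z).
have /= := congr1 (fun w : {t : T & F t} => tagged w == 0) e.
by rewrite eqxx => /eqP.
Qed.

Lemma hsum_in_eq1 s t (a : F s) : hsum_in a = hsum_in (1 : F t) <-> a = 1.
Proof.
split=> [|->]; last exact: hsum_in1.
case/hsum_in_eq => [e|[-> z]|[] //]; last by rewrite (glueF s (esym z)).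
have /= := congr1 (fun w : {t : T & F t} => tagged w == 1) e.
by rewrite eqxx => /eqP.
Qed.

Lemma hsum_oplus_same (x y : H) t (a b : F t) :
    repr (x : Q) = Tagged F a ->
    repr (y : Q) = Tagged F b ->
  hsum_oplus x y = omap (@hsum_in t) (a \oplus b).
Proof. by move=> xa yb; rewrite /hsum_oplus xa yb /= eqxx tagged_asE. Qed.

Lemma hsum_oplus0x (y : H) t : hsum_oplus (hsum_in (0 : F t)) y = Some y.
Proof.
set x := hsum_in _.
have xE := hsum_in_repr x; have yE := hsum_in_repr y.
case xu: (repr (x : Q)) xE => [r a] /= /hsum_in_eq0 a0.
case yu: (repr (y : Q)) yE => [s b] /= yE.
have [rs|nrs] := eqVneq r s; last first.
  by rewrite /hsum_oplus xu yu /= (negPf nrs) a0 eqxx.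
case: _ / rs b yu yE => b yu yE.
by rewrite (hsum_oplus_same xu yu) a0 oplus0x /= yE.
Qed.

Lemma hsum_oplusx0 (x : H) t : hsum_oplus x (hsum_in (0 : F t)) = Some x.
Proof.
set y := hsum_in _.
have xE := hsum_in_repr x; have yE := hsum_in_repr y.
case xu: (repr (x : Q)) xE => [r a] /= xE.
case yu: (repr (y : Q)) yE => [s b] /= /[dup] yE /hsum_in_eq0 b0.
have [rs|nrs] := eqVneq r s; last first.
  rewrite /hsum_oplus xu yu /= (negPf nrs) b0 eqxx; case: eqP => // a0.
  by rewrite -xE a0 -yE b0 (hsum_in0 r s).
case: _ / rs b yu yE b0 => b yu _ b0.
by rewrite (hsum_oplus_same xu yu) b0 oplusx0 /= xE.
Qed.

Lemma hsum_oplusP (x y z : H) :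
  hsum_oplus x y = Some z <->
  exists t (a b c : F t), [/\ x = hsum_in a, y = hsum_in b, z = hsum_in c
                            & a \oplus b = Some c].
Proof.
split.
  have xE := hsum_in_repr x; have yE := hsum_in_repr y.
  case xu: (repr (x : Q)) xE => [s a] /= xE.
  case yu: (repr (y : Q)) yE => [t b] /= yE.
  have [st|nst] := eqVneq s t.
    case: _ / st b yu yE => b yu yE; rewrite (hsum_oplus_same xu yu).
    case ab: (a \oplus b) => [c|//] [<-].
    by exists s, a, b, c.
  rewrite /hsum_oplus xu yu /= (negPf nst); case: eqVneq => [a0 [<-]|na0].
    by exists t, 0, b, b; split=> //; rewrite ?oplus0x // -xE a0 (hsum_in0 s t).
  case: eqVneq => [b0 [<-]|//].
  by exists s, a, 0, a; split=> //; rewrite ?oplusx0 // -yE b0 (hsum_in0 t s).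
case=> r [a [b [c [xa yb -> abc]]]].
have [a0|na0] := eqVneq a 0.
  by move: abc; rewrite xa a0 oplus0x hsum_oplus0x yb => -[->].
have [b0|nb0] := eqVneq b 0.
  by move: abc; rewrite yb b0 oplusx0 hsum_oplusx0 xa => -[->].
have nb1 : b <> 1.
  move=> b1; move/eqP: na0; apply; apply: oplus_one.
  by rewrite -b1 abc.
have na1 : a <> 1.
  move=> a1; move/eqP: nb0; apply; apply: oplus_one.
  by rewrite oplusC -a1 abc.
have xu : repr (x : Q) = Tagged F a.
  have /hsum_in_eq := etrans (hsum_in_repr x) xa; case=> [|[_ /eqP]|[_ /na1 //]].
    by rewrite taggedK.
  by rewrite (negPf na0).
have yu : repr (y : Q) = Tagged F b.
  have /hsum_in_eq := etrans (hsum_in_repr y) yb; case=> [|[_ /eqP]|[_ /nb1 //]].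
    by rewrite taggedK.
  by rewrite (negPf nb0).
by rewrite (hsum_oplus_same xu yu) abc.
Qed.

Lemma hsum_oplus_in t (a b : F t) :
  hsum_oplus (hsum_in a) (hsum_in b) = omap (@hsum_in t) (a \oplus b).
Proof.
case ab: (a \oplus b) => [c|] /=; first by apply/hsum_oplusP; exists t, a, b, c.
case E: hsum_oplus => [z|//].
move/hsum_oplusP: E => [s [a' [b' [c [aE bE _ abc]]]]].
have st : s = t \/ a = 0 \/ b = 0.
  have [->|/eqP nst] := eqVneq s t; first by left.
  right; case/hsum_in_eq: aE => [/(congr1 (@tag _ _)) /= e|[-> _]|[a1 a1']].
  - by case: nst.
  - by left.
  right; apply/(@hsum_in_eq0 t s); rewrite bE.
  by apply/hsum_in_eq0; move: abc; rewrite a1' => /oplus1x.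
case: st => [st|[z0|z0]]; last 2 first.
- by rewrite z0 oplus0x in ab.
- by rewrite z0 oplusx0 in ab.
case: _ / st a b ab aE bE => a b ab /hsum_in_inj aE /hsum_in_inj bE.
by rewrite aE bE abc in ab.
Qed.

Lemma hsum_oplusC (x y : H) : hsum_oplus x y = hsum_oplus y x.
Proof.
suff sub (u v w : H) : hsum_oplus u v = Some w -> hsum_oplus v u = Some w.
  case xy: (hsum_oplus x y) => [z|]; first by rewrite (sub _ _ _ xy).
  by case yx: (hsum_oplus y x) => [z|//]; rewrite (sub _ _ _ yx) in xy.
move=> /hsum_oplusP[t [a [b [c [-> -> -> abc]]]]].
by apply/hsum_oplusP; exists t, b, a, c; rewrite oplusC.
Qed.

Lemma hsum_oplusA (x y z u w : H) :
    hsum_oplus x y = Some u -> hsum_oplus u z = Some w ->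
  exists2 v, hsum_oplus y z = Some v & hsum_oplus x v = Some w.
Proof.
move=> /hsum_oplusP[t [a [b [c [-> -> -> abc]]]]].
move=> /hsum_oplusP[s [c' [d [e [cE -> -> cde]]]]].
have [ts|/eqP nts] := eqVneq t s.
  case: _ / ts c' d e cE cde => c' d e /hsum_in_inj <- cde.
  have [v bdv ave] := @oplusA _ _ _ _ _ _ abc cde.
  by exists (hsum_in v); rewrite hsum_oplus_in ?bdv ?ave.
case/hsum_in_eq: cE => [/(congr1 (@tag _ _)) //|[c0 c0']|[c1 c1']].
- move: abc cde; rewrite c0 c0' oplus0x => /oplus_eq0[-> ->] [->].
  by exists (hsum_in e); rewrite hsum_oplus0x.
- move: cde; rewrite c1' => /[dup] /oplus1x -> ; rewrite oplus10 => -[<-].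
  exists (hsum_in b); first by rewrite hsum_oplusx0.
  by rewrite hsum_oplus_in abc c1 /= (hsum_in1 t s).
Qed.

Lemma hsum_orthosupplement (x : H) :
  exists! y, hsum_oplus x y = Some (hsum_in (1 : F t0)).
Proof.
have [t [a ->]] := hsum_in_surj x.
exists (hsum_in (ea_compl a)); split.
  by rewrite hsum_oplus_in ea_complP /= (hsum_in1 t t0).
move=> y /hsum_oplusP[s [a' [b [c [aE -> /esym/hsum_in_eq1 -> ab1]]]]].
have -> : b = ea_compl a' by apply: ea_compl_uniq.
have c0 r : ea_compl (0 : F r) = 1 by apply/esym/ea_compl_uniq; rewrite oplus0x.
have c1 r : ea_compl (1 : F r) = 0 by apply/esym/ea_compl_uniq; rewrite oplus10.
apply/hsum_in_eq; have [ts|/eqP nts] := eqVneq t s.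
  by case: _ / ts a' {ab1 b} aE => a' /hsum_in_inj ->; constructor 1.
case/hsum_in_eq: aE => [/(congr1 (@tag _ _)) //|[-> ->]|[-> ->]].
  by constructor 3; rewrite !c0.
by constructor 2; rewrite !c1.
Qed.

Lemma hsum_oplus_one (x : H) :
  hsum_oplus x (hsum_in (1 : F t0)) -> x = hsum_in (0 : F t0).
Proof.
case E: hsum_oplus => [z|//] _; move/hsum_oplusP: E => [t [a [b [c]]]].
move=> [-> /esym/hsum_in_eq1 -> _ ac]; apply/hsum_in_eq0.
by apply: oplus_one; rewrite ac.
Qed.

HB.instance Definition _ := isEffectAlgebra.Build H
  hsum_oplusC hsum_oplusA hsum_orthosupplement hsum_oplus_one.

End HorizontalSum.

(* Main.v *)
From HB Require Import structures.
Require Import Defs.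
From mathcomp Require Import all_boot.
From mathcomp Require Import zify.

Set Implicit Arguments.
Unset Strict Implicit.
Unset Printing Implicit Defensive.

Local Open Scope effect_scope.
Local Open Scope quotient_scope.

(* If [n * a] is the largest defined multiple of an atom [a], homogeneity makes
   it sharp: an atom below [n * a] and its complement equals [a], and then
   [(n + 1) * a] would be defined.  So [n * a = 1].  Distinct atoms [a], [b]
   are not orthogonal: if [j * a] is orthogonal to [b], with [0 < j < n], write
   [(n - j) * a] as the sum of [b] and some [y]; as [a] is below this sum, which
   is below the complement of [a], homogeneity puts [a] below [y], so
   [(j + 1) * a] is orthogonal to [b].  Hence finally [1] is orthogonal to [b].
   It follows that each nonzero element is a multiple of any atom below it and
   that two nonzero orthogonal elements are multiples of the same atom. *)

(** * Cancellation, order and multiples in an effect algebra *)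

Section EffectAlgebraOrder.
Variable E : effectAlgebraType.
Implicit Types x y z : E.

Lemma oplus_assocl x y z u w : x \oplus y = Some u -> u \oplus z = Some w ->
  exists2 v, y \oplus z = Some v & x \oplus v = Some w.
Proof. exact: oplusA. Qed.

Lemma oplus_assocr x y z v w : y \oplus z = Some v -> x \oplus v = Some w ->
  exists2 u, x \oplus y = Some u & u \oplus z = Some w.
Proof.
rewrite oplusC => zy; rewrite oplusC => vx.
have [u yx zu] := oplus_assocl zy vx.
by exists u; rewrite oplusC.
Qed.

(** Both [y] and [z] are the orthosupplement of [x \oplus ea_compl w], so uniqueness of
    orthosupplements identifies them. *)
Lemma oplus_cancel x y z w :
  x \oplus y = Some w -> x \oplus z = Some w -> y = z.
Proof.
have ww := ea_complP w => xy xz.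
have [v xv yv] := oplus_assocl (etrans (oplusC y x) xy) ww.
have [v' xv' zv] := oplus_assocl (etrans (oplusC z x) xz) ww.
move: xv'; rewrite xv => -[vv']; rewrite -vv' in zv.
rewrite oplusC in yv; rewrite oplusC in zv.
by rewrite (ea_compl_uniq yv) (ea_compl_uniq zv).
Qed.

Lemma ea_le_refl x : x <= x.
Proof. by exists 0; rewrite oplusx0. Qed.

Lemma ea_le0x x : 0 <= x.
Proof. by exists x; rewrite oplus0x. Qed.

Lemma ea_lex1 x : x <= 1.
Proof. by exists (ea_compl x); rewrite ea_complP. Qed.

Lemma ea_le_oplusl x y z : x \oplus y = Some z -> x <= z.
Proof. by exists y. Qed.

Lemma ea_le_oplusr x y z : x \oplus y = Some z -> y <= z.
Proof. by move=> xy; exists x; rewrite oplusC. Qed.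

Lemma ea_le_trans y x z : x <= y -> y <= z -> x <= z.
Proof. by move=> [u xu] [v yv]; have [w _ xw] := oplus_assocl xu yv; exists w. Qed.

Lemma ea_le_anti x y : x <= y -> y <= x -> x = y.
Proof.
move=> [u xu] [v yv]; have [w uv xw] := oplus_assocl xu yv.
move: uv; rewrite (oplus_cancel xw (oplusx0 x)) => /oplus_eq0[u0 _].
by move: xu; rewrite u0 oplusx0 => -[].
Qed.

Lemma ea_le0 x : x <= 0 -> x = 0.
Proof. by move=> x0; apply: ea_le_anti x0 (ea_le0x x). Qed.

Lemma oplus_le x y z : y <= z -> x \oplus z -> x \oplus y.
Proof.
move=> [u yu]; case xz: (x \oplus z) => [w|//] _.
by have [v -> _] := oplus_assocr yu xz.
Qed.

Lemma oplus_le2 x y z t : x <= z -> y <= t -> z \oplus t -> x \oplus y.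
Proof.
by move=> xz yt /(oplus_le yt); rewrite oplusC => /(oplus_le xz); rewrite oplusC.
Qed.

Lemma oplus_leE x y : x \oplus y <-> y <= ea_compl x.
Proof.
split=> [|yx]; last by apply: oplus_le yx _; rewrite ea_complP.
case xy: (x \oplus y) => [w|//] _.
have [v yv xv] := oplus_assocl xy (ea_complP w).
by exists (ea_compl w); rewrite yv (ea_compl_uniq xv).
Qed.

Lemma ea_compl_le x y : x <= ea_compl y -> y <= ea_compl x.
Proof. by move/oplus_leE => yx; apply/oplus_leE; rewrite oplusC. Qed.

Definition ea_mul (n : nat) (x : E) : option E :=
  iter n (obind (oplus x)) (Some 0).

Lemma ea_mulS n x y : ea_mul n.+1 x = Some y <->
  exists2 z, ea_mul n x = Some z & x \oplus z = Some y.
Proof.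
rewrite /ea_mul iterS -/(ea_mul n x).
case: (ea_mul n x) => [z|] /=; last by split=> // -[].
by split=> [xz|[_ [<-]]//]; exists z.
Qed.

Lemma ea_mul1 x : ea_mul 1 x = Some x.
Proof. exact: oplusx0. Qed.

Lemma ea_mulD m n x z : ea_mul (m + n) x = Some z <->
  exists y1 y2, [/\ ea_mul m x = Some y1, ea_mul n x = Some y2
                  & y1 \oplus y2 = Some z].
Proof.
elim: m z => [|m IHm] z.
  rewrite add0n; split=> [nz|[y1 [y2 [[<-] -> ]]]]; last by rewrite oplus0x.
  by exists 0, z; rewrite oplus0x.
rewrite addSn; split.
  case/ea_mulS => y /IHm [y1 [y2 [m1 n2 y12]]] xy.
  have [u xu uy2] := oplus_assocr y12 xy.
  by exists u, y2; split=> //; apply/ea_mulS; exists y1.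
case=> u [y2 [/ea_mulS [y1 m1 xy1] n2 uy2]].
have [v y12 xv] := oplus_assocl xy1 uy2.
by apply/ea_mulS; exists v => //; apply/IHm; exists y1, y2.
Qed.

Lemma ea_mul_sub m n x z : (m <= n)%N -> ea_mul n x = Some z ->
  exists y1 y2, [/\ ea_mul m x = Some y1, ea_mul (n - m) x = Some y2
                  & y1 \oplus y2 = Some z].
Proof. by move=> mn nz; apply/ea_mulD; rewrite subnKC. Qed.

Lemma ea_mul_eq0 n x : (0 < n)%N -> ea_mul n x = Some 0 -> x = 0.
Proof. by case: n => // n _ /ea_mulS[z _ /oplus_eq0[]]. Qed.

Lemma ea_le_mul n x y : (0 < n)%N -> ea_mul n x = Some y -> x <= y.
Proof. by case: n => // n _ /ea_mulS[z _ /ea_le_oplusl]. Qed.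

(** For [m <= n], cancelling [m * x] leaves [(n - m) * x = 0], and a positive multiple of a nonzero
    element is not [0]. *)
Lemma ea_mul_inj m n x y : x <> 0 ->
  ea_mul m x = Some y -> ea_mul n x = Some y -> m = n.
Proof.
move=> x0; wlog le_mn : m n / (m <= n)%N => [wl|] mx nx.
  by case/orP: (leq_total m n) => h; [|apply/esym]; apply: wl h _ _.
have [y1 [y2 [m1 r2]]] := ea_mul_sub le_mn nx.
move: m1; rewrite mx => -[<-] yy2.
move: r2; rewrite (oplus_cancel yy2 (oplusx0 y)) => r0.
case: (ltnP m n) => [lt_mn|]; last by move=> ?; apply/eqP; rewrite eqn_leq le_mn.
by case: x0; apply: ea_mul_eq0 r0; rewrite subn_gt0.
Qed.

End EffectAlgebraOrder.

(** * Atoms under homogeneity *)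

Definition atom (E : effectAlgebraType) (a : E) : Prop :=
  a <> 0 /\ forall b, b <= a -> b = 0 \/ b = a.

Section HomogeneousAtoms.
Variable E : effectAlgebraType.
Hypothesis homE : homogeneous E.
Implicit Types a b x y : E.

Lemma atom_le a b : atom a -> atom b -> b <= a -> b = a.
Proof. by move=> [_ a_min] [b0 _] /a_min[]. Qed.

(** Homogeneity splits [a] into a part below [x] and a part below [y]; by minimality of [a] one part
    is [0] and the other is [a]. *)
Lemma atom_le_oplus a x y z : atom a -> x \oplus y = Some z ->
  a <= z -> z <= ea_compl a -> a <= x \/ a <= y.
Proof.
move=> [a0 a_min] xyz az za.
have [u1 [u2 [ux uy u12]]] := homE xyz az za.
case: (a_min u1 (ea_le_oplusl u12)) => u1E; rewrite u1E in u12 ux.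
  by right; move: u12; rewrite oplus0x => -[<-].
by left.
Qed.

(** Split off one copy of [a] at a time: [b] lies below that copy or below the rest, and the rest is
    still below [ea_compl b]. *)
Lemma atom_le_mul a b n z : atom a -> atom b -> ea_mul n a = Some z ->
  b <= z -> z <= ea_compl b -> b = a.
Proof.
move=> a_atom b_atom; elim: n z => [|n IHn] z.
  by case=> <- /ea_le0 b0; case: b_atom.
case/ea_mulS => y ny ay bz zb.
case: (atom_le_oplus b_atom ay bz zb) => [|b_y]; first exact: atom_le.
by apply: IHn ny b_y _; apply: ea_le_trans zb; apply: ea_le_oplusr ay.
Qed.

Lemma atom_orth_eq a b n : atom a -> atom b -> ea_mul n a = Some 1 ->
  a \oplus b -> a = b.
Proof.
move=> a_atom b_atom na ab; case: (eqVneq a b) => // /eqP a_neq_b.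
have orth j : (0 < j <= n)%N -> exists2 y, ea_mul j a = Some y & y \oplus b.
  elim: j => // -[_ _|j IHj /andP[_ j_lt_n]]; first by exists a; rewrite ?ea_mul1.
  have [|y jy yb] := IHj; first by rewrite /= ltnW.
  have [y' [w [j' nj yw]]] := ea_mul_sub (ltnW j_lt_n) na.
  move: j'; rewrite jy => -[y_y']; rewrite -{}y_y' in yw.
  have wE := ea_compl_uniq yw.
  have [v bv] : b <= w by rewrite wE; apply/oplus_leE.
  (* [w] is [(n - j) * a] for the current positive [j < n], hence a positive multiple of [a]. *)
  have aw : a <= w by apply: ea_le_mul nj; rewrite subn_gt0.
  have wa : w <= ea_compl a.
    apply/oplus_leE/(oplus_le2 (ea_le_mul (ltn0Sn j) jy) (ea_le_refl w)).
    by rewrite yw.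
  case: (atom_le_oplus a_atom bv aw wa) => [/(atom_le b_atom a_atom)//|[v' av]].
  (* Now [1] is the sum of [y], [b], [a] and [v']; regrouping shows that [y \oplus a], the next
     multiple of [a], is orthogonal to [b]. *)
  have [u yu ub] := oplus_assocr bv yw.
  have [t ut] := oplus_assocr av ub; case: (oplus_assocl yu ut) => // r ba yr _.
  rewrite oplusC in ba; have [s ya sb] := oplus_assocr ba yr.
  by exists s; [apply/ea_mulS; exists y; rewrite // oplusC|rewrite sb].
have [n0|n_gt0] := posnP n.
  case: b_atom => b0 _; case: b0; apply: ea_le0.
  by move: na; rewrite n0 => -[->]; apply: ea_lex1.
have [|y] := orth n; first by rewrite n_gt0 leqnn.
rewrite na => -[<-]; rewrite oplusC => /oplus_one b0.
by case: b_atom.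
Qed.

End HomogeneousAtoms.

(** * Finite homogeneous effect algebras with trivial sharp elements *)

Section FiniteEffectAlgebra.
Variable E : finEffectAlgebraType.
Implicit Types a b x y : E.

(** A decidable order lets lower sets be counted and atoms be collected in a subtype. *)
Definition ea_leb x y := [exists z, x \oplus z == Some y].

Lemma ea_leP x y : reflect (x <= y) (ea_leb x y).
Proof. by apply: (iffP existsP) => -[z /eqP]; exists z => //; apply/eqP. Qed.

Definition atomb a :=
  (a != 0) && [forall b, ea_leb b a ==> (b == 0) || (b == a)].

Lemma atomP a : reflect (atom a) (atomb a).
Proof.
apply: (iffP andP) => -[/eqP a0 a_min]; split=> //.
  move=> b /ea_leP ba; move/forallP/(_ b)/implyP/(_ ba): a_min.
  by case/orP => /eqP; [left|right].
apply/forallP => b; apply/implyP => /ea_leP /a_min[] ->; rewrite eqxx ?orbT //.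
Qed.

(** Induction on the number of elements below [x]: if [x] is not an atom, some nonzero element
    strictly below it has a smaller lower set. *)
Lemma atom_below x : x <> 0 -> exists2 a, atom a & a <= x.
Proof.
have [n] := ubnP #|[pred z | ea_leb z x]|; elim: n x => // n IHn x lt_n /eqP x0.
case: (boolP (atomb x)) => [/atomP ?|].
  by exists x => //; apply: ea_le_refl.
rewrite /atomb x0 /= negb_forall => /existsP[b].
rewrite negb_imply negb_or => /andP[/ea_leP bx /andP[/eqP b0 /eqP b_neq_x]].
have [|//|a a_atom ab] := IHn b; last by exists a => //; apply: ea_le_trans bx.
apply: leq_trans (lt_n : _ <= n)%N; apply/proper_card/properP; split.
  apply/subsetP => z; rewrite !inE => /ea_leP zb.
  by apply/ea_leP/(ea_le_trans zb).
exists x; rewrite !inE; first exact/ea_leP/ea_le_refl.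
by apply/ea_leP => xb; apply/b_neq_x/ea_le_anti.
Qed.

(** The multiples [i * x] with [i < n] are pairwise distinct. The bound provides a largest defined
    multiple. *)
Lemma ea_mul_bound n x : x <> 0 -> ea_mul n x -> (n <= #|E|)%N.
Proof.
move=> x0; case nx: (ea_mul n x) => [z|//] _.
have def (i : 'I_n) : exists y, ea_mul i x == Some y.
  have [y [_ [iy _ _]]] := ea_mul_sub (ltnW (ltn_ord i)) nx.
  by exists y; apply/eqP.
have f_inj : injective (fun i => xchoose (def i)).
  move=> i j /= fij; apply/val_inj/(@ea_mul_inj _ _ _ x _ x0).
    exact/eqP/(xchooseP (def i)).
  by rewrite fij; exact/eqP/(xchooseP (def j)).
by have := leq_card _ f_inj; rewrite card_ord.
Qed.

Hypothesis homE : homogeneous E.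
Hypothesis sharpE : forall x : E, sharp x -> x = 0 \/ x = 1.

Lemma atom_mul1 a : atom a -> exists n, ea_mul n a = Some 1.
Proof.
move=> a_atom; have [a0 _] := a_atom.
have ex_def : exists n, isSome (ea_mul n a) by exists 0%N.
case: (ex_maxnP ex_def (fun n => @ea_mul_bound n a a0)) => n.
case na: (ea_mul n a) => [z|//] _ n_max; exists n; rewrite na.
have n_gt0 : (0 < n)%N by apply: n_max; rewrite ea_mul1.
(* Sharpness of [z] remains to be shown; the outcome [z = 0] is excluded by [n_gt0]. *)
case: (@sharpE z) => [y yz yz'|z0|->//]; last first.
  by case: a0; apply: ea_mul_eq0 n_gt0 _; rewrite na z0.
apply/eqP/negPn/negP => /eqP/atom_below[b b_atom b_y].
have bz' := ea_le_trans b_y yz'.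
have ba := atom_le_mul homE a_atom b_atom na (ea_le_trans b_y yz) (ea_compl_le bz').
move: bz'; rewrite ba => /oplus_leE; rewrite oplusC.
case az: (a \oplus z) => [w|//] _.
have /n_max : isSome (ea_mul n.+1 a).
  by have -> : ea_mul n.+1 a = Some w by apply/ea_mulS; exists z.
by rewrite ltnn.
Qed.

Lemma atom_orth a b : atom a -> atom b -> a \oplus b -> a = b.
Proof.
by move=> a_atom b_atom; have [n na] := atom_mul1 a_atom; apply: atom_orth_eq na.
Qed.

(** Climb through the multiples of [a] below [x]. If [j * a] is not yet [x], an atom below the
    difference is orthogonal to [a], so it is [a], and the next multiple is below [x] too. The climb
    stops at [1] at the latest. *)
Lemma atom_le_multiple a x : atom a -> a <= x -> exists n, ea_mul n a = Some x.
Proof.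
move=> a_atom ax; have [n na] := atom_mul1 a_atom.
have multiple_or_above j : (0 < j <= n)%N -> (exists i, ea_mul i a = Some x) \/
    exists2 y, ea_mul j a = Some y & y <= x.
  elim: j => // -[_ _|j IHj /andP[_ j_lt_n]].
    by right; exists a; rewrite ?ea_mul1.
  have [|?|[y jy [z yz]]] := IHj; [by rewrite /= ltnW|by left|].
  have [z0|/eqP/atom_below [b b_atom [c bc]]] := eqVneq z 0.
    by left; exists j.+1; rewrite jy; move: yz; rewrite z0 oplusx0.
  have [u yb uc] := oplus_assocr bc yz.
  have ab : a = b.
    apply: atom_orth => //; apply: oplus_le2 (ea_le_mul _ jy) (ea_le_refl b) _ => //.
    by rewrite yb.
  right; exists u; last exact: ea_le_oplusl uc.
  by apply/ea_mulS; exists y; rewrite // oplusC ab.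
have [n0|n_gt0] := posnP n.
  have z1 : 0 = 1 :> E by move: na; rewrite n0 => -[].
  by case: a_atom => a0; case: a0; apply: ea_le0; rewrite z1; apply: ea_lex1.
have [|//|[y]] := multiple_or_above n; first by rewrite n_gt0 leqnn.
rewrite na => -[<-] x1; exists n.
by rewrite na (ea_le_anti x1 (ea_lex1 x)).
Qed.

End FiniteEffectAlgebra.

(** * Finite chains as initial segments of the natural numbers *)

Section OrdinalChain.
Variable n : nat.

(** The unit will be [n] itself, so [n = 0] gives the one-element algebra. *)
Definition ord_chain := 'I_n.+1.
HB.instance Definition _ := Choice.on ord_chain.

Definition ord_oplus (i j : ord_chain) : option ord_chain := insub (i + j)%N.

Lemma ord_oplusP i j k : ord_oplus i j = Some k <-> (i + j)%N = k.
Proof.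
rewrite /ord_oplus; split=> [|->]; last by rewrite valK.
by case: insubP => // u _ <- [->].
Qed.

Lemma ord_oplusC i j : ord_oplus i j = ord_oplus j i.
Proof. by rewrite /ord_oplus addnC. Qed.

Lemma ord_oplusA i j k u w : ord_oplus i j = Some u -> ord_oplus u k = Some w ->
  exists2 v, ord_oplus j k = Some v & ord_oplus i v = Some w.
Proof.
move=> /ord_oplusP iju /ord_oplusP ukw.
have jk : (j + k < n.+1)%N by have := ltn_ord w; lia.
by exists (Ordinal jk); apply/ord_oplusP => //=; lia.
Qed.

Lemma ord_orthosupplement (i : ord_chain) :
  exists! j, ord_oplus i j = Some (ord_max : ord_chain).
Proof.
exists (rev_ord i); split=> [|j /ord_oplusP /= ij].
  by apply/ord_oplusP => /=; have := ltn_ord i; lia.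
by apply: val_inj => /=; lia.
Qed.

Lemma ord_oplus_one (i : ord_chain) : ord_oplus i ord_max -> i = ord0.
Proof.
case ij: ord_oplus => [k|//] _; move/ord_oplusP: ij => /= ik.
by apply: val_inj => /=; have := ltn_ord k; lia.
Qed.

HB.instance Definition _ := isEffectAlgebra.Build ord_chain
  ord_oplusC ord_oplusA ord_orthosupplement ord_oplus_one.

Lemma chain_ord_chain : chain ord_chain.
Proof.
move=> i j; wlog le_ij : i j / (i <= j)%N => [wl|].
  by case/orP: (leq_total i j) => /wl // []; [right|left].
have ji : (j - i < n.+1)%N by have := ltn_ord j; lia.
by left; exists (Ordinal ji : ord_chain); apply/ord_oplusP => /=; lia.
Qed.

End OrdinalChain.

(** * Recognizing a horizontal sum from embeddings of its members *)

Section HorizontalSumRecognition.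
Variables (E : effectAlgebraType) (T : choiceType) (t0 : T).
Variables (F : T -> effectAlgebraType) (glueF : glueable F).
Variable f : forall t, F t -> E.
Hypothesis f0 : forall t, f (0 : F t) = 0.
Hypothesis f1 : forall t, f (1 : F t) = 1.
Hypothesis fD : forall t (a b : F t), f a \oplus f b = omap (@f t) (a \oplus b).
Hypothesis f_inj : forall t, injective (@f t).
Hypothesis f_sep : forall s t (a : F s) (b : F t),
  f a \oplus f b -> [\/ a = 0, b = 0 | s = t].
Hypothesis f_surj : forall x, exists t (a : F t), x = f a.

(** The maps [f] glue to a bijection [g] onto [E], independent of representatives by [f0] and [f1];
    its inverse [k] is the isomorphism. *)
Lemma hsum_iso : ea_isomorphic E (hsum glueF t0).
Proof.
set H := hsum glueF t0; pose in_ t : F t -> H := @hsum_in T t0 F glueF t.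
pose g (h : H) : E := let u := repr (h : {eq_quot (glue_equiv glueF)}) in
  f (tagged u).
have g_in t (a : F t) : g (in_ t a) = f a.
  have /(@hsum_in_eq T t0) := @hsum_in_repr T t0 F glueF (in_ t a).
  rewrite /g; case: (repr _) => s b /=.
  case=> [|[-> ->]|[-> ->]]; [|by rewrite !f0|by rewrite !f1].
  by move/(congr1 (fun u : {t : T & F t} => f (tagged u))).
have g_inj : injective g.
  move=> h h'; have [s [a ->]] := @hsum_in_surj T t0 F glueF h.
  have [t [b ->]] := @hsum_in_surj T t0 F glueF h'; rewrite !g_in => fab.
  (* Passing to the complement turns the equality [f a = f b] into an orthogonality, to which
     [f_sep] applies: both elements are [1], both are [0], or they share a member. *)
  have fa1 : f (ea_compl a) \oplus f b = Some 1.
    by rewrite -fab fD oplusC ea_complP /= f1.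
  case: (f_sep (a := ea_compl a) (b := b)) => [|a1|b0|st]; first by rewrite fa1.
  - apply/hsum_in_eq; constructor 3; suff a1' : a = 1.
      by split=> //; apply: f_inj; rewrite -fab a1' !f1.
    by have := ea_complP a; rewrite a1 oplusx0 => -[].
  - apply/hsum_in_eq; constructor 2; split=> //.
    by apply: f_inj; rewrite fab b0 !f0.
  - by case: _ / st b fab {fa1} => b /f_inj ->.
have g_surj x : exists h, g h == x.
  by have [t [a ->]] := f_surj x; exists (in_ t a); rewrite g_in.
pose k x : H := xchoose (g_surj x).
have kK x : g (k x) = x by exact/eqP/(xchooseP (g_surj x)).
have gK h : k (g h) = h by apply: g_inj; rewrite kK.
have k_in t (a : F t) : k (f a) = in_ t a by rewrite -g_in gK.
exists k; split.
- by exists g.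
- by rewrite -(f0 t0) k_in.
- by rewrite -(f1 t0) k_in.
(* Additivity of [g] serves to show that [k x \oplus k y] is undefined whenever [x \oplus y] is. *)
have gD (h h' z : H) : h \oplus h' = Some z -> g h \oplus g h' = Some (g z).
  case/hsum_oplusP => t [a [b [c [-> -> -> abc]]]].
  by rewrite !g_in fD abc.
have kD x y z : x \oplus y = Some z -> k x \oplus k y = Some (k z).
  have [s [a ->]] := f_surj x; have [t [b ->]] := f_surj y => abz.
  case: (f_sep (a := a) (b := b)) => [|a0|b0|st]; first by rewrite abz.
  - by move: abz; rewrite a0 f0 oplus0x -(f0 t0) k_in => -[<-]; apply: hsum_oplus0x.
  - by move: abz; rewrite b0 f0 oplusx0 -(f0 t0) (k_in t0) => -[<-]; apply: hsum_oplusx0.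
  case: _ / st b abz => b abz; rewrite !k_in.
  rewrite fD in abz; case ab: (a \oplus b) abz => [c|//] [<-].
  by rewrite k_in; apply/hsum_oplusP; exists s, a, b, c.
move=> x y; case xy: (x \oplus y) => [z|]; first exact: kD.
by case kxy: (k x \oplus k y) => [h|//]; have := gD _ _ _ kxy; rewrite !kK xy.
Qed.

End HorizontalSumRecognition.

(** * The chains generated by the atoms *)

Section Decomposition.
Variable E : finEffectAlgebraType.
Hypothesis homE : homogeneous E.
Hypothesis sharpE : forall x : E, sharp x -> x = 0 \/ x = 1.

(* The one-element algebra has no atoms, but the index set of a horizontal sum
   must be nonempty: there [0] stands in for an atom. *)
Definition generator (a : E) : bool := (0 == 1 :> E) || atomb a.

Definition generators : choiceType := {a : E | generator a}.

Lemma trivial_eq0 (x : E) : 0 = 1 :> E -> x = 0.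
Proof. by move=> z1; apply: ea_le0; rewrite z1; apply: ea_lex1. Qed.


Lemma generator_mul1 (t : generators) : exists n, ea_mul n (val t) == Some 1.
Proof.
case: t => a /= /orP[/eqP z1|/atomP /(atom_mul1 homE sharpE)[n na]].
  by exists 0%N; apply/eqP; congr Some.
by exists n; rewrite na.
Qed.

(** If [0 <> 1], this is also the largest [n] with [n * t] defined, see [ea_mul_le_index]. If
    [0 = 1], every [n] qualifies, and the minimum [0] yields a one-element chain. *)
Definition isotropic_index (t : generators) : nat := ex_minn (generator_mul1 t).

Lemma ea_mul_index t : ea_mul (isotropic_index t) (val t) = Some 1.
Proof. by rewrite /isotropic_index; case: ex_minnP => n /eqP. Qed.

Lemma isotropic_index_eq0 t : isotropic_index t = 0%N <-> 0 = 1 :> E.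
Proof.
split=> [n0|z1]; first by have := ea_mul_index t; rewrite n0 => -[].
rewrite /isotropic_index; case: ex_minnP => n _ /(_ 0%N).
by rewrite /= z1 eqxx leqn0 => /(_ isT)/eqP.
Qed.

Lemma generator_atom (t : generators) : 0 <> 1 :> E -> atom (val t).
Proof. by case: t => a /= /orP[/eqP|/atomP]. Qed.

Definition generated_chain (t : generators) : effectAlgebraType :=
  ord_chain (isotropic_index t).

(** A generated chain is trivial exactly when [E] is, a condition independent of the generator. *)
Lemma glueable_generated_chain : glueable generated_chain.
Proof.
move=> s t /(congr1 val) /= /esym /isotropic_index_eq0 z1.
by apply: val_inj => /=; apply/esym/isotropic_index_eq0.
Qed.

Lemma ea_mul_generated t (i : generated_chain t) :
  exists x, ea_mul i (val t) == Some x.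
Proof.
have le_i : (i <= isotropic_index t)%N by rewrite -ltnS ltn_ord.
have [x [_ [ix _ _]]] := ea_mul_sub le_i (ea_mul_index t).
by exists x; rewrite ix.
Qed.

Definition multiple t (i : generated_chain t) : E := xchoose (ea_mul_generated i).

Lemma multipleP t (i : generated_chain t) :
  ea_mul i (val t) = Some (multiple i).
Proof. exact/eqP/(xchooseP (ea_mul_generated i)). Qed.

Lemma multiple_uniq t (i : generated_chain t) x :
  ea_mul i (val t) = Some x -> multiple i = x.
Proof. by rewrite multipleP => -[]. Qed.

Lemma generated_chain_gt0 t (i : generated_chain t) : i <> 0 -> (0 < i)%N.
Proof. by move=> i0; rewrite lt0n; apply/eqP => ?; apply/i0/val_inj. Qed.

Lemma generated_chain_neq0 t (i : generated_chain t) : i <> 0 -> 0 <> 1 :> E.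
Proof.
move=> /generated_chain_gt0 i0 /isotropic_index_eq0 => /(_ t) n0.
by have := ltn_ord i; rewrite {2}n0; lia.
Qed.

(** A larger defined multiple would be the sum of [1] and a positive multiple of an atom, yet only
    [0] is orthogonal to [1]. *)
Lemma ea_mul_le_index (t : generators) n : 0 <> 1 :> E ->
  ea_mul n (val t) -> (n <= isotropic_index t)%N.
Proof.
move=> z1; have [a0 _] := generator_atom t z1.
case nt: (ea_mul n (val t)) => [z|//] _.
case: leqP => // lt_n.
have [y1 [y2 [iy1 ry2 y12]]] := ea_mul_sub (ltnW lt_n) nt.
move: iy1; rewrite ea_mul_index => -[y1E]; rewrite -y1E in y12.
case: a0; apply: (@ea_mul_eq0 _ (n - isotropic_index t)).
  by rewrite subn_gt0.
by rewrite ry2 (oplus1x y12).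
Qed.

Lemma multiple_oplus t (i j : generated_chain t) :
  multiple i \oplus multiple j = omap (@multiple t) (i \oplus j).
Proof.
case ij: (i \oplus j) => [k|] /=.
  move/ord_oplusP: ij => ij; have := multipleP k; rewrite -ij.
  by case/ea_mulD => x [y []]; rewrite !multipleP => -[<-] [<-].
case xy: (multiple i \oplus multiple j) => [z|//].
have ijz : ea_mul (i + j) (val t) = Some z.
  by apply/ea_mulD; exists (multiple i), (multiple j); rewrite !multipleP.
(* A nonzero [i] ensures [0 <> 1] in [E], as the bound on [i + j] requires. *)
have [i0|/eqP/generated_chain_neq0 z1] := eqVneq i 0.
  by move: ij; rewrite i0 oplus0x.
have le_ij : (i + j < (isotropic_index t).+1)%N.
  by rewrite ltnS; apply: ea_mul_le_index; rewrite ?ijz.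
have : i \oplus j = Some (Ordinal le_ij : generated_chain t) by apply/ord_oplusP.
by rewrite ij.
Qed.

Lemma multiple_inj t : injective (@multiple t).
Proof.
move=> i j ij; have [z1|/eqP z1] := eqVneq (0 : E) 1.
  have n0 := (isotropic_index_eq0 t).2 z1; apply: val_inj => /=.
  by have := ltn_ord i; have := ltn_ord j; rewrite [X in (_ < X.+1)%N]n0; lia.
have [a0 _] := generator_atom t z1.
by apply/val_inj/(ea_mul_inj a0 (multipleP i)); rewrite ij multipleP.
Qed.

(** The atoms [s] and [t] lie below the two nonzero multiples, so they are orthogonal and
    [atom_orth] makes them equal. *)
Lemma multiple_sep s t (i : generated_chain s) (j : generated_chain t) :
  multiple i \oplus multiple j -> [\/ i = 0, j = 0 | s = t].
Proof.
have [->|/eqP i0] := eqVneq i 0; first by constructor 1.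
have [->|/eqP j0] := eqVneq j 0; first by constructor 2.
move=> ij; constructor 3; have z1 := generated_chain_neq0 i0.
apply/val_inj/(atom_orth homE sharpE (generator_atom s z1) (generator_atom t z1)).
by apply: oplus_le2 ij; apply: ea_le_mul (multipleP _); apply: generated_chain_gt0.
Qed.

Lemma generators_inhabited : inhabited generators.
Proof.
have [z1|/eqP z1] := eqVneq (0 : E) 1.
  have g0 : generator 0 by rewrite /generator z1 eqxx.
  by constructor; exact: (exist _ 0 g0).
have [a /atomP aP _] := atom_below (not_eq_sym z1).
have ga : generator a by rewrite /generator aP orbT.
by constructor; exact: (exist _ a ga).
Qed.

Lemma multiple_surj x : exists t (i : generated_chain t), x = multiple i.
Proof.
have [->|/eqP x0] := eqVneq x 0.
  by have [t] := generators_inhabited; exists t, 0; apply/esym/multiple_uniq.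
have [a aP ax] := atom_below x0.
have ga : generator a by rewrite /generator (introT (atomP a) aP) orbT.
have [n na] := atom_le_multiple homE sharpE aP ax.
pose t : generators := exist _ a ga; exists t.
have lt_n : (n < (isotropic_index t).+1)%N.
  rewrite ltnS; apply: ea_mul_le_index; last by rewrite na.
  by move/(trivial_eq0 x).
by exists (Ordinal lt_n : generated_chain t); apply/esym/multiple_uniq.
Qed.

End Decomposition.

Theorem corollary2p3 (E : finEffectAlgebraType)
    (homE : homogeneous E)
    (sharpE : forall x : E, sharp x <-> x = 0 \/ x = 1) :
  exists (T : choiceType) (t0 : T) (F : T -> effectAlgebraType)
         (glueF : glueable F),
    (forall t, chain (F t)) /\ ea_isomorphic E (hsum glueF t0).
Proof.
have sharp01 (x : E) : sharp x -> x = 0 \/ x = 1 by case: (sharpE x).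
have [t0] := generators_inhabited E.
exists (generators E), t0, (generated_chain homE sharp01).
exists (@glueable_generated_chain E homE sharp01).
split=> [t|]; first exact: chain_ord_chain.
apply: (@hsum_iso _ _ _ _ _ (@multiple E homE sharp01)).
- by move=> t; apply: multiple_uniq.
- by move=> t; apply: multiple_uniq; apply: ea_mul_index.
- exact: multiple_oplus.
- exact: multiple_inj.
- exact: multiple_sep.
- exact: multiple_surj.
Qed.
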